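(* Let $C\subset[0,1]$ be the middle-third Cantor set. Let $f$ be any one of the following functions on the indicated open set $U\subset\mathbb{R}^2$: (i) $f(x,y)=x^{\alpha}y^{\beta}$ on $U=(0,\infty)^2$, where $\alpha,\beta\in\mathbb{R}$ with $\alpha\beta\neq 0$; (ii) $f(x,y)=x^{\alpha}+y^{\alpha}$ or $f(x,y)=x^{\alpha}-y^{\alpha}$ on $U=(0,\infty)^2$, where $\alpha\in\mathbb{R}$ with $\alpha\neq 0$; (iii) $f(x,y)=x+y^2$ or $f(x,y)=x-y^2$ on $U=\mathbb{R}^2$; (iv) $f(x,y)=\sin(x)\cos(y)$ on $U=\mathbb{R}^2$. Then the set $f_U(C,C)=\{f(x,y):(x,y)\in (C\times C)\cap U\}\subset\mathbb{R}$ has non-empty interior in $\mathbb{R}$.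
   Context: The middle-third Cantor set $C$ is the unique non-empty compact subset of $\mathbb{R}$ satisfying $C=f_1(C)\cup f_2(C)$, where $f_1(x)=\frac{x}{3}$ and $f_2(x)=\frac{x+2}{3}$. *)

(* Defs.v *)
From HB Require Import structures.
From mathcomp Require Import all_boot all_order all_algebra.
From mathcomp Require Import all_classical all_reals all_analysis.

Set Implicit Arguments.
Unset Strict Implicit.
Unset Printing Implicit Defensive.

Import Order.TTheory GRing.Theory Num.Theory.
Import numFieldNormedType.Exports.

Local Open Scope classical_set_scope.
Local Open Scope ring_scope.

(* By Hutchinson's theorem exactly one set C has this property. *)
Definition middle_third_cantor_set (R : realType) (C : set R) : Prop :=
  [/\ C !=set0, compact C &
      C = [set x / 3 | x in C] `|` [set (x + 2) / 3 | x in C]].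

Definition image_on (R : realType) (U : set (R * R)) (f : R -> R -> R)
    (A B : set R) : set R :=
  [set f p.1 p.2 | p in (A `*` B) `&` U].

Definition open_quadrant (R : realType) : set (R * R) :=
  `]0, +oo[ `*` `]0, +oo[.

Arguments open_quadrant : clear implicits.

(* Main.v *)
(** Let [g] and [k] be increasing on [[0, 1]] with slopes in [[q, 3 p]] and
    [[p, q]] respectively.  The four first-level corner squares of [[0, 1]^2]
    have images under [g x + k y] that overlap consecutively and hence cover
    the image of the whole square: the condition "slope of [k] <= slope of [g]"
    closes the gaps between squares in the same column, the condition "slope of
    [g] <= 3 slope of [k]" the gap between the two columns.  The hypothesis is
    invariant under zooming in, so every value of [g x + k y] on the square is
    approximated, and by compactness attained, on the product of two Cantor
    sets.  Zooming in at points [x0], [y0] of [C] where [|g'| / |k'|] lies in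
    [(1/3, 3)] and differs from [1] therefore produces an interval in
    [g(C) + k(C)]; decreasing functions are dealt with by the symmetry
    [x |-> 1 - x].  Products are turned into sums by the logarithm, and each
    case then only needs a suitable pair of points [x0], [y0]; when the ratio
    is identically [1] (case (ii) with [alpha = 1]) the slopes are constant and
    no zooming argument is required. *)

Require Import Defs.
From HB Require Import structures.
From mathcomp Require Import all_boot all_order all_algebra.
From mathcomp Require Import all_classical all_reals all_analysis.
From mathcomp Require Import ring lra.

Set Implicit Arguments.
Unset Strict Implicit.
Unset Printing Implicit Defensive.

Import Order.TTheory GRing.Theory Num.Theory.
Import numFieldNormedType.Exports.

Local Open Scope classical_set_scope.
Local Open Scope ring_scope.

(** * Small powers of 1/3 and non-empty interiors *)

Lemma expr_inv3_small (R : realType) (e : R) :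
  0 < e -> exists n : nat, 3^-1 ^+ n < e.
Proof.
move=> e0; have [n en] : exists n : nat, e^-1 < n%:R.
  by exists (Num.bound e^-1); rewrite archi_boundP// invr_ge0 ltW.
exists n; rewrite exprVn invf_plt ?posrE ?exprn_gt0//.
apply: lt_le_trans en _; elim: n => [|n IHn]; first by rewrite expr0 ler01.
rewrite exprS -natr1; have : 1 <= (3 : R) ^+ n by rewrite exprn_ege1// ler1n.
by move: IHn; lra.
Qed.

Lemma interior_itvoo_neq0 (R : realType) (S : set R) (a b : R) :
  a < b -> (forall z, a < z < b -> S z) -> (S°)%classic !=set0.
Proof.
move=> ab abS; exists ((a + b) / 2).
have : nbhs ((a + b) / 2) `]a, b[%classic.
  by apply: near_in_itvoo; rewrite in_itv/=; apply/andP; split; lra.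
by apply: filterS => z /=; rewrite in_itv/=; exact: abS.
Qed.

Section cantor.
Variable R : realType.
Implicit Types (A B C : set R) (g k : R -> R).

(** * Self-similarity, symmetry and bounds of the Cantor set *)

Lemma cantor_third C x : middle_third_cantor_set C -> C x -> C (x / 3).
Proof. by case=> _ _ eqC Cx; rewrite eqC; left; exists x. Qed.

Lemma cantor_two_thirds C x :
  middle_third_cantor_set C -> C x -> C ((x + 2) / 3).
Proof. by case=> _ _ eqC Cx; rewrite eqC; right; exists x. Qed.

Lemma cantor_split C x : middle_third_cantor_set C -> C x ->
  exists2 y, C y & x = y / 3 \/ x = (y + 2) / 3.
Proof.
case=> _ _ eqC; rewrite {1}eqC => -[] [y Cy <-]; exists y => //.
  by left.
by right.
Qed.

(** The reflection x |-> 1 - x exchanges the two contractions: 1 - y/3 = ((1 - y) + 2)/3. *)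
Lemma cantor_reflect C : middle_third_cantor_set C ->
  middle_third_cantor_set [set 1 - x | x in C].
Proof.
move=> hC; have [[c Cc] cC eqC] := hC; split; first by exists (1 - c), c.
  apply: (@continuous_compact _ _ (fun x : R => 1 - x)) => //.
  apply: continuous_subspaceT => x.
  apply: (@cvgB _ R^o); [exact: cvg_cst|exact: cvg_id].
apply/seteqP; split=> z.
  move=> [x /(cantor_split hC)[y Cy [->|->]] <-]; [right|left].
    by exists (1 - y); [exists y|field].
  by exists (1 - y); [exists y|field].
move=> [|] [_ [y Cy <-] <-].
  exists ((y + 2) / 3); last by field.
  exact: cantor_two_thirds.
exists (y / 3); last by field.
exact: cantor_third.
Qed.

(** By compactness there is a largest element s. Since (s + 2)/3 is in C, s >= 1; writing s as y/3
    or (y + 2)/3 with y <= s gives s <= 1. *)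
Lemma cantor_max C : middle_third_cantor_set C ->
  C 1 /\ forall x, C x -> x <= 1.
Proof.
move=> hC; have [C0 cC _] := hC.
have [s /set_mem Cs sup] : exists2 s, s \in C & forall t, t \in C -> t <= s.
  apply: (@compact_EVT_max _ _ (fun x : R => x)) => //.
  by apply: continuous_subspaceT => x; exact: cvg_id.
have s1 : 1 <= s.
  by have := sup _ (mem_set (cantor_two_thirds hC Cs)); lra.
have s1' : s <= 1.
  have [y Cy ys] := cantor_split hC Cs.
  by have := sup _ (mem_set Cy); case: ys; lra.
have <- : s = 1 by apply/le_anti/andP.
by split=> // x Cx; apply: sup; exact: mem_set.
Qed.

Lemma cantor01 C x : middle_third_cantor_set C -> C x -> 0 <= x <= 1.
Proof.
move=> hC Cx; rewrite (cantor_max hC).2// andbT.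
have /(_ (1 - x)) := (cantor_max (cantor_reflect hC)).2.
by move/(_ (imageP _ Cx)); lra.
Qed.

(** * Sums of two Cantor sets under slope bounds *)

Definition slopes_in (p q : R) g := forall x x', 0 <= x -> x <= x' -> x' <= 1 ->
  p * (x' - x) <= g x' - g x <= q * (x' - x).

Lemma slopes_in_third p q g i : 0 <= i <= 2 -> slopes_in p q g ->
  slopes_in (p / 3) (q / 3) (fun x => g ((x + i) / 3)).
Proof.
move=> i02 hg x x' x0 xx' x1.
have := hg ((x + i) / 3) ((x' + i) / 3).
have -> : (x' + i) / 3 - (x + i) / 3 = (x' - x) / 3 by field.
rewrite !(mulrAC _ 3^-1) -!mulrA; apply; lra.
Qed.

Lemma slopes_in_continuous p q g C : middle_third_cantor_set C ->
  0 <= p -> slopes_in p q g -> {within C, continuous g}.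
Proof.
move=> hC p0 hg; apply/subspace_continuousP => x Cx.
apply/cvgrPdist_lt => e e0; rewrite near_withinE.
(* On [0, 1] the function [g] is Lipschitz with constant |q|; adding 1 keeps the divisor
   positive. *)
have d0 : 0 < e / (`|q| + 1) by rewrite divr_gt0// ltr_wpDl.
have : \forall t \near x, `|x - t| < e / (`|q| + 1).
  by apply/nbhs_ballP; exists (e / (`|q| + 1)).
apply: filterS => t xt Ct; move: xt; rewrite ltr_pdivlMr ?ltr_wpDl// => xt.
apply: le_lt_trans xt.
have /andP[x0 x1] := cantor01 hC Cx; have /andP[t0 t1] := cantor01 hC Ct.
have qq : q <= `|q| by exact: ler_norm.
wlog tx : x t {Cx Ct} x0 x1 t0 t1 / t <= x => [th|].
  have [/th->//|/ltW xt] := leP t x.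
  by rewrite distrC (distrC x); exact: th.
have /andP[gl gu] := hg _ _ t0 tx x1.
have gp : 0 <= p * (x - t) by rewrite mulr_ge0// subr_ge0.
rewrite (ger0_norm (le_trans gp gl)) (ger0_norm (_ : 0 <= x - t)) ?subr_ge0//.
apply: le_trans gu _; rewrite mulrC ler_wpM2l ?subr_ge0//; lra.
Qed.

(** Induction on the level [n]. The slopes and functions are quantified after [n] because the
    induction hypothesis is applied to the functions rescaled from a corner square, with p/3 and
    q/3. The factor 3p + q bounds the oscillation of g x + k y on the unit square. Keeping [A] and
    [B] separate allows either one to be a reflected Cantor set. *)
Lemma cantor_sum_approx A B n : middle_third_cantor_set A ->
  middle_third_cantor_set B -> forall p q g k z, 0 <= p -> p <= q ->
  slopes_in q (3 * p) g -> slopes_in p q k ->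
  g 0 + k 0 <= z <= g 1 + k 1 ->
  exists x y, [/\ A x, B y & `|g x + k y - z| <= (3 * p + q) * 3^-1 ^+ n].
Proof.
move=> hA hB; elim: n => [|n IHn] p q g k z p0 pq hg hk /andP[z0 z1].
  have [[x Ax] _ _] := hA; have [[y By] _ _] := hB.
  exists x, y; split=> //; rewrite expr0 mulr1.
  have /andP[x0 x1] := cantor01 hA Ax; have /andP[y0 y1] := cantor01 hB By.
  have := hg 0 x (lexx _) x0 x1; have := hg x 1 x0 x1 (lexx _).
  have := hk 0 y (lexx _) y0 y1; have := hk y 1 y0 y1 (lexx _).
  have := hg 0 1 (lexx _) ler01 (lexx _); have := hk 0 1 (lexx _) ler01 (lexx _).
  move=> ? ? ? ? ? ?.
  have ? : 0 <= q * x by apply: mulr_ge0; lra.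
  have ? : 0 <= p * y by apply: mulr_ge0; lra.
  have ? : 0 <= q * (1 - x) by apply: mulr_ge0; lra.
  have ? : 0 <= p * (1 - y) by apply: mulr_ge0; lra.
  by rewrite ler_norml; lra.
(* The digits i and j select a corner square of side 1/3; it remains to find one whose image
   contains z. *)
have sub i j : (i = 0 \/ i = 2) -> (j = 0 \/ j = 2) ->
    g (i / 3) + k (j / 3) <= z <= g ((1 + i) / 3) + k ((1 + j) / 3) ->
  exists x y, [/\ A x, B y & `|g x + k y - z| <= (3 * p + q) * 3^-1 ^+ n.+1].
  move=> hi hj hz.
  have i02 : 0 <= i <= 2 by case: hi => ->; lra.
  have j02 : 0 <= j <= 2 by case: hj => ->; lra.
  have := IHn (p / 3) (q / 3) _ _ z _ _ (_ : slopes_in _ _ _)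
    (slopes_in_third j02 hk).
  have := slopes_in_third i02 hg; rewrite -mulrA => hg' /(_ _ _ _ hg').
  case; [lra|lra|by rewrite !add0r|].
  move=> x [y [Ax By xyz]]; exists ((x + i) / 3), ((y + j) / 3); split.
  - case: hi => ->; last exact: cantor_two_thirds.
    by rewrite addr0; exact: cantor_third.
  - case: hj => ->; last exact: cantor_two_thirds.
    by rewrite addr0; exact: cantor_third.
  - by apply: le_trans xyz _; rewrite exprS; lra.
(* By [k1] with [g1] and [g3], the images of the two squares in each column overlap; by [k2] with
   [g2], the upper left image meets the lower right one. *)
have k1 : k (2 / 3) - k (1 / 3) <= q / 3.
  by have := hk (1/3) (2/3); lra.
have k2 : p <= k 1 - k 0 by have := hk 0 1; lra.
have g1 : q / 3 <= g (1 / 3) - g 0.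
  by have := hg 0 (1/3); lra.
have g2 : g (2 / 3) - g (1 / 3) <= p by have := hg (1/3) (2/3); lra.
have g3 : q / 3 <= g 1 - g (2 / 3) by have := hg (2/3) 1; lra.
have e0 : 0 / 3 = 0 :> R by rewrite mul0r.
have e1 : (1 + 2) / 3 = 1 :> R by field.
have [z00|z00] := leP z (g (1 / 3) + k (1 / 3)).
  by apply: (sub 0 0); [left|left|rewrite e0 addr0; lra].
have [z01|z01] := leP z (g (1 / 3) + k 1).
  by apply: (sub 0 2); [left|right|rewrite e0 e1 addr0; lra].
have [z10|z10] := leP z (g 1 + k (1 / 3)).
  by apply: (sub 2 0); [right|left|rewrite e0 e1 addr0; lra].
by apply: (sub 2 2); [right|right|rewrite e1; lra].
Qed.

(** The approximations put z in the closure of g(A) + k(B), which is compact and hence closed. *)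
Lemma cantor_sum A B p q g k z : middle_third_cantor_set A ->
  middle_third_cantor_set B -> 0 <= p -> p <= q ->
  slopes_in q (3 * p) g -> slopes_in p q k ->
  g 0 + k 0 <= z <= g 1 + k 1 ->
  exists x y, [/\ A x, B y & g x + k y = z].
Proof.
move=> hA hB p0 pq hg hk hz.
have q0 : 0 <= q by exact: le_trans pq.
pose S := [set u.1 + u.2 | u in (g @` A) `*` (k @` B)].
have cS : compact S.
  apply: continuous_compact.
    by apply: continuous_subspaceT => u; exact: add_continuous.
  apply: compact_setX; apply: continuous_compact.
  - exact: slopes_in_continuous hg.
  - by case: hA.
  - exact: slopes_in_continuous hk.
  - by case: hB.
have : closure S z.
  move=> V /nbhs_ballP[e /= e0 eV].
  have d0 : 0 < e / (3 * p + q + 1) by rewrite divr_gt0//; lra.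
  have [n] := expr_inv3_small d0; rewrite ltr_pdivlMr; last lra.
  move=> ne.
  have [x [y [Ax By xyz]]] := cantor_sum_approx n hA hB p0 pq hg hk hz.
  exists (g x + k y); split.
    exists (g x, k y) => //; split => /=; first by exists x.
    by exists y.
  apply: eV; rewrite /ball/= distrC; apply: le_lt_trans xyz _.
  apply: le_lt_trans ne; rewrite mulrC ler_wpM2l ?exprn_ge0//; lra.
rewrite -(closure_id S).1; last exact: compact_closed (@Rhausdorff _) cS.
by move=> [[_ _] [[x Ax <-] [y By <-]] <-]; exists x, y.
Qed.

(** * Zooming in at points of the Cantor set *)

(** Both points vary: zooming needs slope bounds between any two points of a small cell, which
    differentiability at [x0] alone does not give. *)
Definition strict_derivative g (x0 d : R) := forall e, 0 < e ->
  exists2 r, 0 < r & forall x x', `|x - x0| < r -> `|x' - x0| < r -> x <= x' ->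
    `|g x' - g x - d * (x' - x)| <= e * (x' - x).

(** By the mean value theorem an increment of [g] near [x0] is the length of the interval times a
    value of [dg] there, which continuity keeps within e of [dg x0]. *)
Lemma is_derive_strict g (dg : R -> R) (x0 : R) :
  (\forall x \near x0, is_derive (x : R) 1 g (dg x)) -> {for x0, continuous dg} ->
  strict_derivative g x0 (dg x0).
Proof.
move=> hg cdg e e0.
have /nbhs_ballP[r /= r0 hr] : \forall x \near x0,
    is_derive (x : R) 1 g (dg x) /\ `|dg x0 - dg x| < e.
  by near=> x; split; near: x => //; exact: cvgr_dist_lt.
exists r => // x x' xr xr' xx'.
have xx'r t : t \in `[x, x'] -> is_derive t 1 g (dg t) /\ `|dg x0 - dg t| < e.
  rewrite in_itv/= => t01; apply: hr.
  by move: xr xr'; rewrite /ball/= !ltr_norml; lra.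
have [||c /xx'r[_]] := @MVT_segment R g dg x x' xx'.
- by move=> t /subset_itv_oo_cc /xx'r[].
- by apply: derivable_within_continuous => t /xx'r[] [].
rewrite ltr_norml => ce ->.
rewrite -mulrBl normrM (ger0_norm (_ : 0 <= x' - x)) ?subr_ge0//.
by rewrite ler_wpM2r ?subr_ge0// ltW// distrC ltr_norml.
Unshelve. all: by end_near. Qed.

(** Composing the n contractions given by the first n ternary digits of x yields the cell. *)
Lemma cantor_cell C x n : middle_third_cantor_set C -> C x ->
  exists2 a, a <= x <= a + 3^-1 ^+ n & forall u, C u -> C (a + 3^-1 ^+ n * u).
Proof.
move=> hC; elim: n x => [|n IHn] x Cx.
  exists 0; first by rewrite add0r expr0; exact: cantor01 Cx.
  by move=> u Cu; rewrite expr0 add0r mul1r.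
have [y Cy xy] := cantor_split hC Cx; have [a ay ha] := IHn _ Cy.
case: xy => ->.
  exists (a / 3); first by rewrite exprS; lra.
  move=> u /ha /(cantor_third hC); congr C.
  by rewrite exprS; field.
exists ((a + 2) / 3); first by rewrite exprS; lra.
move=> u /ha /(cantor_two_thirds hC); congr C.
by rewrite exprS; field.
Qed.

(** [G] is [g] on a small cell around [x0], rescaled to [0, 1]; for d < 0 both [g] and [C] are
    reflected first. Every large [n] is allowed, so that two functions can be zoomed by the same
    factor. *)
Lemma cantor_zoom C g x0 d p q r : middle_third_cantor_set C -> C x0 ->
  strict_derivative g x0 d -> 0 < r -> p < `|d| < q -> exists N, forall n,
  (N <= n)%N -> exists A G, [/\ middle_third_cantor_set A,
    slopes_in (p * 3^-1 ^+ n) (q * 3^-1 ^+ n) G &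
    forall u, A u -> exists x, [/\ C x, `|x - x0| < r & g x = G u]].
Proof.
wlog d0 : C g x0 d / 0 <= d => [wlog_d hC Cx0 hg r0 pdq|].
  have [/wlog_d|/ltW d0] := leP 0 d; first exact.
  have hg' : strict_derivative (fun x => g (1 - x)) (1 - x0) (- d).
    move=> e /hg[s s0 hs]; exists s => // x x' xs xs' xx'.
    have := hs (1 - x') (1 - x).
    have -> : 1 - x - (1 - x') = x' - x by ring.
    have -> : 1 - x - x0 = - (x - (1 - x0)) by ring.
    have -> : 1 - x' - x0 = - (x' - (1 - x0)) by ring.
    rewrite !normrN => /(_ xs' xs); rewrite !ler_norml; lra.
  have := wlog_d _ _ _ _ _ (cantor_reflect hC) (imageP _ Cx0) hg' r0.
  rewrite oppr_ge0 normrN => /(_ d0 pdq)[N hN].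
  exists N => n /hN[A [G [hA hG AG]]].
  exists A, G; split=> // u /AG[_ [[x Cx <-] xx0 gx]].
  exists x; split=> //; last by rewrite -gx; congr g; ring.
  by rewrite -normrN (_ : - _ = 1 - x - (1 - x0))//; ring.
rewrite ger0_norm// => hC Cx0 hg r0 /andP[pd dq].
(* With this tolerance the slopes stay between p and q. *)
have [|s s0 hs] := hg (Num.min (d - p) (q - d)).
  by rewrite lt_min !subr_gt0 pd.
have [|N hN] := @expr_inv3_small R (Num.min r s); first by rewrite lt_min r0.
exists N => n Nn.
have [a ax Ca] := cantor_cell n hC Cx0.
have h0 : 0 < 3^-1 ^+ n :> R by rewrite exprn_gt0.
have hr : 3^-1 ^+ n < Num.min r s.
  by apply: le_lt_trans hN; rewrite ler_wiXn2l//; lra.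
have near_x0 u : 0 <= u <= 1 -> `|a + 3^-1 ^+ n * u - x0| < Num.min r s.
  move=> u01; apply: le_lt_trans hr; rewrite ler_norml.
  have : 0 <= 3^-1 ^+ n * u by rewrite mulr_ge0//; lra.
  have : 0 <= 3^-1 ^+ n * (1 - u) by rewrite mulr_ge0//; lra.
  lra.
exists C, (fun u => g (a + 3^-1 ^+ n * u)); split=> //.
  move=> u u' u0 uu' u1.
  have := hs (a + 3^-1 ^+ n * u) (a + 3^-1 ^+ n * u').
  have -> : a + 3^-1 ^+ n * u' - (a + 3^-1 ^+ n * u) = 3^-1 ^+ n * (u' - u).
    by ring.
  have := near_x0 u; have := near_x0 u'; rewrite !lt_min.
  move=> /(_ _)/andP[|_ ->]; first lra.
  move=> /(_ _)/andP[|_ ->]; first lra.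
  rewrite lerD2l (ler_wpM2l (ltW h0) uu') => /(_ isT isT isT).
  rewrite ler_norml => /andP[lo up].
  have uu0 : 0 <= 3^-1 ^+ n * (u' - u) by rewrite mulr_ge0 ?(ltW h0)// subr_ge0.
  rewrite -!mulrA; apply/andP; split.
    have : Num.min (d - p) (q - d) * (3^-1 ^+ n * (u' - u)) <=
           (d - p) * (3^-1 ^+ n * (u' - u)).
      by rewrite ler_wpM2r// ge_min lexx.
    lra.
  have : Num.min (d - p) (q - d) * (3^-1 ^+ n * (u' - u)) <=
         (q - d) * (3^-1 ^+ n * (u' - u)).
    by rewrite ler_wpM2r// ge_min lexx orbT.
  lra.
move=> u Cu; exists (a + 3^-1 ^+ n * u); split=> //; first exact: Ca.
by have := near_x0 _ (cantor01 hC Cu); rewrite lt_min => /andP[].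
Qed.

Lemma cantor_sum_itv C g k x0 y0 d e : middle_third_cantor_set C ->
  C x0 -> C y0 -> 0 < x0 -> 0 < y0 ->
  strict_derivative g x0 d -> strict_derivative k y0 e ->
  `|d| < 3 * `|e| -> `|e| < 3 * `|d| -> `|d| != `|e| ->
  exists a b, a < b /\ forall z, a < z < b ->
    exists x y, [/\ C x, C y, 0 < x, 0 < y & g x + k y = z].
Proof.
move=> hC; wlog de : g k x0 y0 d e / `|e| < `|d| => [wlog_de|].
  move=> Cx0 Cy0 x00 y00 hg hk d3e e3d; rewrite neq_lt => /orP[de|ed].
    have [|a [b [ab hab]]] :=
      wlog_de _ _ _ _ _ _ de Cy0 Cx0 y00 x00 hk hg e3d d3e.
      by rewrite gt_eqF.
    exists a, b; split=> // z /hab[x [y [Cx Cy x_gt0 y_gt0 <-]]].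
    by exists y, x; split=> //; rewrite addrC.
  by apply: (wlog_de _ _ _ _ _ _ ed Cx0 Cy0) => //; rewrite gt_eqF.
move=> Cx0 Cy0 x00 y00 hg hk d3e _ _.
(* These midpoints satisfy p < |e| < q < |d| < 3p. The radii of the zooms below are [x0] and [y0],
   which keeps the points found positive. *)
set q := (`|d| + `|e|) / 2; set p := (`|d| / 3 + `|e|) / 2.
have e0 : 0 <= `|e| by [].
have [|N hN] := @cantor_zoom _ _ _ _ q (3 * p) _ hC Cx0 hg x00.
  by rewrite /p /q; lra.
have [|M hM] := @cantor_zoom _ _ _ _ p q _ hC Cy0 hk y00.
  by rewrite /p /q; lra.
have [A [G [hA hG AG]]] := hN (maxn N M) (leq_maxl _ _).
have [B [K [hB hK BK]]] := hM (maxn N M) (leq_maxr _ _).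
have h0 : 0 < 3^-1 ^+ maxn N M :> R by rewrite exprn_gt0.
have p0 : 0 < p * 3^-1 ^+ maxn N M by rewrite mulr_gt0// /p; lra.
have pq : p * 3^-1 ^+ maxn N M <= q * 3^-1 ^+ maxn N M.
  by rewrite ler_pM2r// /p /q; lra.
exists (G 0 + K 0), (G 1 + K 1); split.
  have := hG 0 1 (lexx _) ler01 (lexx _); have := hK 0 1 (lexx _) ler01 (lexx _).
  lra.
move=> z /andP[/ltW z0 /ltW z1]; move: hG; rewrite -(mulrA 3) => hG.
have [|u [v [/AG[x [Cx xx0 <-]] /BK[y [Cy yy0 <-]] xyz]]] :=
  cantor_sum (z := z) hA hB (ltW p0) pq hG hK; first by rewrite z0.
exists x, y; split=> //.
  by move: xx0; rewrite ltr_norml; lra.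
by move: yy0; rewrite ltr_norml; lra.
Qed.

(** * Strict derivatives of the elementary functions *)

Lemma image_on_quadrantI C (f : R -> R -> R) x y :
  C x -> C y -> 0 < x -> 0 < y ->
  image_on (open_quadrant R) f C C (f x y).
Proof.
move=> Cx Cy x0 y0; exists (x, y) => //=.
by split; split=> //=; rewrite in_itv/= andbT.
Qed.

Lemma strict_derivativeZ g x0 d c : c != 0 -> strict_derivative g x0 d ->
  strict_derivative (fun x => c * g x) x0 (c * d).
Proof.
move=> c0 hg e e0; have c0' : 0 < `|c| by rewrite normr_gt0.
have [|r r0 hr] := hg (e / `|c|); first by rewrite divr_gt0.
exists r => // x x' xr xr' xx'.
rewrite [X in `|X|](_ : _ = c * (g x' - g x - d * (x' - x))); last by ring.
rewrite normrM mulrC -ler_pdivlMr// mulrAC; exact: hr.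
Qed.

Lemma continuous_powRl (a x : R) : 0 < x -> {for x, continuous (@powR R ^~ a)}.
Proof.
move=> x0; have : derivable (@powR R ^~ a) x 1.
  by apply: derivable_powR; rewrite in_itv/= andbT.
by move=> /derivable1_diffP/differentiable_continuous.
Qed.

Lemma strict_derivative_powR a x : 0 < x ->
  strict_derivative (@powR R ^~ a) x (a * x `^ (a - 1)).
Proof.
move=> x0; apply: (@is_derive_strict _ (fun x => a * x `^ (a - 1))).
  near=> z; apply: is_derive1_powR; near: z; exact: lt_nbhsr.
by apply: continuousM; [exact: cvg_cst|exact: continuous_powRl].
Unshelve. all: by end_near. Qed.

Lemma strict_derivative_ln x : 0 < x -> strict_derivative (@ln R) x x^-1.
Proof.
move=> x0; apply: (@is_derive_strict _ (fun x => x^-1)).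
  near=> z; apply: is_derive1_ln; near: z; exact: lt_nbhsr.
by apply: inv_continuous; rewrite gt_eqF.
Unshelve. all: by end_near. Qed.

Lemma strict_derivative_ln_sin (x : R) : 0 < sin x ->
  strict_derivative (fun x => ln (sin x)) x (cos x / sin x).
Proof.
move=> x0; apply: (@is_derive_strict _ (fun x => cos x / sin x)).
  have : \forall z \near x, 0 < sin z.
    exact: (cvgr_gt _ (@continuous_sin R x)).
  apply: filterS => z z0.
  by have := is_derive1_comp (is_derive1_ln z0) (is_derive_sin z); rewrite mulrC.
apply: cvgM; first exact: continuous_cos.
by apply: cvgV; [rewrite gt_eqF|exact: continuous_sin].
Qed.

Lemma strict_derivative_ln_cos (x : R) : 0 < cos x ->
  strict_derivative (fun x => ln (cos x)) x (- (sin x / cos x)).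
Proof.
move=> x0; apply: (@is_derive_strict _ (fun x => - (sin x / cos x))).
  have : \forall z \near x, 0 < cos z.
    exact: (cvgr_gt _ (@continuous_cos R x)).
  apply: filterS => z z0.
  have := is_derive1_comp (is_derive1_ln z0) (is_derive_cos z).
  by rewrite mulrN mulrC.
apply: cvgN; apply: cvgM; first exact: continuous_sin.
by apply: cvgV; [rewrite gt_eqF|exact: continuous_cos].
Qed.

(** * Case (i): products of powers *)

Lemma cantor_scale C x n : middle_third_cantor_set C -> C x ->
  C (x * 3^-1 ^+ n).
Proof.
move=> hC Cx; elim: n => [|n IHn]; first by rewrite expr0 mulr1.
by rewrite exprSr mulrA; exact: cantor_third.
Qed.

Lemma cantor_two_thirds_mem C : middle_third_cantor_set C -> C (2 / 3).
Proof.
move=> hC; rewrite -[2]add0r; apply: cantor_two_thirds => //.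
have [[x Cx x1] _] := cantor_max (cantor_reflect hC).
by rewrite (_ : 0 = x)//; lra.
Qed.

(* Powers of [3] and their multiples by [3 / 2] all occur as ratios of points
   of [C]. *)
Lemma cantor_ratio C t : middle_third_cantor_set C -> 0 < t ->
  exists x y, [/\ C x, C y, 0 < x, 0 < y & 1 < t * (y / x) < 3].
Proof.
move=> hC t0; have C1 := (cantor_max hC).1; have C23 := cantor_two_thirds_mem hC.
have h0 n : 0 < 3^-1 ^+ n :> R by rewrite exprn_gt0.
(* Multiplying t by 3^n makes it exceed 1; dividing by the least 3^m that brings it below 3 leaves
   it in [1, 3). If the result is exactly 1, replacing x = 3^-n by (2/3) 3^-n turns it into 3/2. *)
have [n nt] := expr_inv3_small t0.
set s := t / 3^-1 ^+ n; have s1 : 1 < s by rewrite ltr_pdivlMr// mul1r.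
have /ex_minnP[m m3 min_m] : exists m, s * 3^-1 ^+ m < 3.
  have [|m] := @expr_inv3_small R (3 / s); first by rewrite divr_gt0//; lra.
  by rewrite ltr_pdivlMr ?(lt_trans ltr01)// mulrC; exists m.
have s3 : 1 <= s * 3^-1 ^+ m.
  case: m m3 min_m => [|m] m3 min_m; first by rewrite expr0 mulr1 ltW.
  have : ~~ (s * 3^-1 ^+ m < 3) by apply/negP => /min_m; rewrite ltnn.
  by rewrite -leNgt exprS; lra.
have := s3; rewrite le_eqVlt => /orP[/eqP|] s3'.
  exists (2 / 3 * 3^-1 ^+ n), (1 * 3^-1 ^+ m); split.
  - exact: cantor_scale.
  - exact: cantor_scale.
  - by rewrite mulr_gt0.
  - by rewrite mulr_gt0.
  - have -> : t * (1 * 3^-1 ^+ m / (2 / 3 * 3^-1 ^+ n)) =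
        s * 3^-1 ^+ m * (3 / 2).
      by rewrite /s; field; rewrite gt_eqF.
    by rewrite -s3'; lra.
exists (1 * 3^-1 ^+ n), (1 * 3^-1 ^+ m); split.
- exact: cantor_scale.
- exact: cantor_scale.
- by rewrite mulr_gt0.
- by rewrite mulr_gt0.
- have -> : t * (1 * 3^-1 ^+ m / (1 * 3^-1 ^+ n)) = s * 3^-1 ^+ m.
    by rewrite /s; field; rewrite gt_eqF.
  by rewrite s3'.
Qed.

(** The logarithm is alpha ln x + beta ln y, whose partial derivatives have ratio (|alpha| / |beta|)
    (y / x) in absolute value; [cantor_ratio] places it strictly between 1 and 3. *)
Lemma cantor_powR_mul C alpha beta : middle_third_cantor_set C ->
  alpha * beta != 0 ->
  (image_on (open_quadrant R) (fun x y => x `^ alpha * y `^ beta) C C)° !=set0.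
Proof.
move=> hC; rewrite mulf_eq0 negb_or => /andP[alpha0 beta0].
have [|x [y [Cx Cy x0 y0 /andP[t1 t3]]]] :=
  @cantor_ratio C (`|alpha| / `|beta|) hC; first by rewrite divr_gt0 ?normr_gt0.
have eqt : `|alpha * x^-1| = `|alpha| / `|beta| * (y / x) * `|beta * y^-1|.
  rewrite !normrM !normfV !(gtr0_norm x0) !(gtr0_norm y0); field.
  by rewrite normr_eq0 beta0 !gt_eqF.
have b0 : 0 < `|beta * y^-1| by rewrite normr_gt0 mulf_neq0// invr_eq0 gt_eqF.
have [|||a [b [ab hab]]] := cantor_sum_itv hC Cx Cy x0 y0
  (strict_derivativeZ alpha0 (strict_derivative_ln x0))
  (strict_derivativeZ beta0 (strict_derivative_ln y0)).
- by rewrite eqt ltr_pM2r.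
- rewrite eqt; nra.
- by rewrite eqt gt_eqF//; nra.
apply: (@interior_itvoo_neq0 _ _ (expR a) (expR b)); first by rewrite ltr_expR.
move=> z /andP[az zb]; have z0 : 0 < z by apply: lt_trans az; exact: expR_gt0.
have [|u [v [Cu Cv u0 v0 uv]]] := hab (ln z).
  by rewrite -(expRK a) -(expRK b) !ltr_ln ?posrE ?expR_gt0// az.
have -> : z = u `^ alpha * v `^ beta.
  by rewrite /powR !gt_eqF// -expRD uv lnK.
exact: (@image_on_quadrantI _ (fun x y => x `^ alpha * y `^ beta)).
Qed.

(** * Case (ii): sums and differences of powers *)

(** Here [cantor_sum] applies directly with p = q = 1/3, on the right-hand third (x + 2)/3 of C in
    both variables, where the points are positive. For c = -1 the second Cantor set is reflected to
    make the summand increasing. The function [g] stands for the power with exponent 1. *)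
Lemma cantor_linear C c g : middle_third_cantor_set C -> `|c| = 1 ->
  (forall x, 0 < x -> g x = x) ->
  (image_on (open_quadrant R) (fun x y => g x + c * g y) C C)° !=set0.
Proof.
move=> hC c1 gE.
have [B [K [hB hK BK]]] : exists B K, [/\ middle_third_cantor_set B,
    slopes_in (1 / 3) (1 / 3) K &
    forall v, B v -> exists2 w, C w & c * ((w + 2) / 3) = K v].
  have [c0|c0] := leP 0 c.
    exists C, (fun w => (w + 2) / 3); split=> // [x x' _ _ _|w Cw]; first lra.
    by exists w => //; rewrite -(ger0_norm c0) c1 mul1r.
  exists [set 1 - x | x in C], (fun w => - ((1 - w + 2) / 3)).
  split=> [|x x' _ _ _|_ [w Cw <-]]; [exact: cantor_reflect|lra|].
  exists w => //; have -> : c = -1 by rewrite -c1 ltr0_norm// opprK.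
  by field.
have hG : slopes_in (1 / 3) (3 * (1 / 3)) (fun x : R => (x + 2) / 3).
  by move=> x x' _ xx' _; lra.
apply: (@interior_itvoo_neq0 _ _ ((0 + 2) / 3 + K 0) ((1 + 2) / 3 + K 1)).
  by have := hK 0 1 (lexx _) ler01 (lexx _); lra.
move=> z /andP[/ltW z0 /ltW z1].
have [|||x [y [Cx /BK[w Cw <-] <-]]] := cantor_sum (z := z) hC hB _ _ hG hK.
- lra.
- lra.
- by rewrite z0.
have /andP[x0 _] := cantor01 hC Cx; have /andP[w0 _] := cantor01 hC Cw.
rewrite -[(x + 2) / 3]gE -1?[(w + 2) / 3]gE; try by lra.
apply: (@image_on_quadrantI _ (fun x y => g x + c * g y)).
- exact: cantor_two_thirds.
- exact: cantor_two_thirds.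
- lra.
- lra.
Qed.

Lemma cantor_powR_add C alpha c : middle_third_cantor_set C -> alpha != 0 ->
  `|c| = 1 ->
  (image_on (open_quadrant R) (fun x y => x `^ alpha + c * y `^ alpha) C C)°
    !=set0.
Proof.
move=> hC alpha0 c1; have [->|alpha1] := eqVneq alpha 1.
  apply: (@cantor_linear _ _ (@powR R ^~ 1)) => // x /ltW; exact: powRr1.
have a10 : alpha - 1 != 0 by rewrite subr_eq0.
(* The derivatives at [1] and at [y := 1 - 3^-n.+1] have ratio
   [y `^ (alpha - 1)], which tends to [1] but never equals [1]. *)
have [r r0 hr] : exists2 r, 0 < r &
    forall y, `|1 - y| < r -> 1 / 3 < y `^ (alpha - 1) < 3.
  have cont := continuous_powRl (a := alpha - 1) (@ltr01 R).
  have : \forall y \near (1 : R), 1 / 3 < y `^ (alpha - 1) < 3.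
    near=> y; apply/andP; split; near: y.
      by apply: (cvgr_gt _ cont); rewrite powR1; lra.
    by apply: (cvgr_lt _ cont); rewrite powR1; lra.
  by move=> /nbhs_ballP[r /= r0 hr]; exists r.
have [n nr] := expr_inv3_small r0.
(* The exponent n + 1 gives y >= 2/3 even for n = 0; y lies in C by symmetry. *)
pose y : R := 1 - 1 * 3^-1 ^+ n.+1.
have h0 : 0 < 3^-1 ^+ n :> R by rewrite exprn_gt0.
have h1 : 3^-1 ^+ n <= 1 :> R by rewrite exprn_ile1//; lra.
have y0 : 0 < y by rewrite /y exprS; lra.
have C1 := (cantor_max hC).1.
have Cy : C y.
  have [x Cx xE] := cantor_scale n.+1 (cantor_reflect hC)
    (cantor_max (cantor_reflect hC)).1.
  by rewrite (_ : y = x)// /y -xE; ring.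
have /andP[yl yu] : 1 / 3 < y `^ (alpha - 1) < 3.
  by apply: hr; rewrite ger0_norm /y exprS; lra.
have c0 : c != 0 by rewrite -normr_eq0 c1 oner_eq0.
have na : 0 < `|alpha| by rewrite normr_gt0.
have [|||a [b [ab hab]]] := cantor_sum_itv hC C1 Cy ltr01 y0
  (strict_derivative_powR alpha ltr01)
  (strict_derivativeZ c0 (strict_derivative_powR alpha y0)).
- rewrite powR1 mulr1 !normrM c1 mul1r (gtr0_norm (powR_gt0 _ y0)); nra.
- rewrite powR1 mulr1 !normrM c1 mul1r (gtr0_norm (powR_gt0 _ y0)); nra.
- rewrite powR1 mulr1 !normrM c1 mul1r (gtr0_norm (powR_gt0 _ y0)).
  rewrite -[X in X != _]mulr1 (inj_eq (mulfI (lt0r_neq0 na))) eq_sym powR_eq1.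
  by rewrite !negb_or a10 -leNgt ltW// andbT lt_eqF// /y exprS; lra.
apply: (@interior_itvoo_neq0 _ _ a b) => // z /hab[u [v [Cu Cv u0 v0 <-]]].
exact: (@image_on_quadrantI _ (fun x y => x `^ alpha + c * y `^ alpha)).
Unshelve. all: end_near. Qed.

(** * Case (iii): a linear term plus or minus a square *)

Lemma strict_derivative_id (x : R) : strict_derivative id x 1.
Proof.
move=> e e0; exists 1 => // u u' _ _ uu'.
by rewrite mul1r subrr normr0 mulr_ge0 ?subr_ge0// ltW.
Qed.

Lemma strict_derivative_sqr (x : R) :
  strict_derivative (fun x => x ^+ 2) x (2 * x).
Proof.
move=> e e0; exists (e / 2); first by rewrite divr_gt0.
move=> u u' ux u'x uu'.
rewrite (_ : _ - _ - _ = (u - x + (u' - x)) * (u' - u)); last by ring.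
rewrite normrM (ger0_norm (_ : 0 <= u' - u)) ?subr_ge0//.
rewrite ler_wpM2r ?subr_ge0//; apply: le_trans (ler_normD _ _) _; lra.
Qed.

(** At the point (1, 1) the derivatives are 1 and 2c, of ratio 2 in absolute value. *)
Lemma cantor_add_sqr C c : middle_third_cantor_set C -> `|c| = 1 ->
  (image_on setT (fun x y => x + c * y ^+ 2) C C)° !=set0.
Proof.
move=> hC c1; have C1 := (cantor_max hC).1.
have c0 : c != 0 by rewrite -normr_eq0 c1 oner_eq0.
have c2 : `|c * (2 * 1)| = 2 by rewrite normrM c1 mul1r mulr1 ger0_norm.
have [|||a [b [ab hab]]] := cantor_sum_itv hC C1 C1 ltr01 ltr01
  (@strict_derivative_id 1)
  (strict_derivativeZ c0 (@strict_derivative_sqr 1)).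
- by rewrite c2 normr1; lra.
- by rewrite c2 normr1; lra.
- by rewrite c2 normr1 lt_eqF//; lra.
apply: (@interior_itvoo_neq0 _ _ a b) => // z /hab[u [v [Cu Cv _ _ <-]]].
by exists (u, v).
Qed.

(** * Case (iv): the product of sine and cosine *)

(** The mean value theorem gives sin x = x cos t with 0 < t < x, and cosine decreases on [0, 1]. *)
Lemma sin_cos_mid (x : R) : 0 < x -> x <= 1 -> x * cos x <= sin x <= x.
Proof.
move=> x0 x1.
have [|c] := @MVT R (@sin R) (@cos R) 0 x x0.
  by apply: continuous_subspaceT => t; exact: continuous_sin.
rewrite in_itv/= => /andP[c0 cx]; rewrite sin0 !subr0 => ->.
rewrite mulrC ler_pM2r// ltW; last first.
  have := @pi_ge2 R.
  by move=> pi2; rewrite ltr_cos//= in_itv/=; lra.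
by rewrite ler_piMl ?cos_le1// ltW.
Qed.

Lemma cos_gt0_le1 (x : R) : 0 <= x <= 1 -> 0 < cos x.
Proof.
move=> /andP[x0 x1]; apply: lt_le_trans (@cos1_gt0 R) _.
have [->//|x1'] := eqVneq x 1; rewrite ltW// ltr_cos ?in_itv/=.
- by rewrite lt_neqAle x1'.
- by have := @pi_ge2 R; lra.
- by have := @pi_ge2 R; lra.
Qed.

Lemma cantor_sin_cos C : middle_third_cantor_set C ->
  (image_on setT (fun x y => sin x * cos y) C C)° !=set0.
Proof.
move=> hC; have C23 := cantor_two_thirds_mem hC.
have a0 : 0 < 2 / 3 :> R by rewrite divr_gt0.
have s0 : 0 < sin (2 / 3 : R) by apply: sin2_gt0; lra.
have c0 : 0 < cos (2 / 3 : R) by apply: cos_gt0_le1; lra.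
(* The derivatives of [ln \o sin] and [ln \o cos] at [2 / 3] have ratio
   [- cot (2 / 3) ^ 2], and [1 < cot (2 / 3) ^ 2 < 3]. *)
set s := sin (2 / 3 : R) in s0 *; set c := cos (2 / 3 : R) in c0 *.
have /andP[sl su] : 2 / 3 * c <= s <= 2 / 3 by apply: sin_cos_mid; lra.
have sc : c ^+ 2 + s ^+ 2 = 1 by exact: cos2Dsin2.
(* From s <= 2/3 follows s^2 <= 4/9 < 1/2, hence s^2 < c^2; from s >= (2/3) c follows 3 s^2 >= (4/3)
   c^2 > c^2. *)
have s2c2 : s ^+ 2 < c ^+ 2 < 3 * s ^+ 2.
  have : s ^+ 2 <= (2 / 3) ^+ 2 by rewrite ler_sqr ?nnegrE; lra.
  have : (2 / 3 * c) ^+ 2 <= s ^+ 2 by rewrite ler_sqr ?nnegrE; lra.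
  by rewrite !exprMn; lra.
have lt_ratio (p q u v : R) : 0 < u -> 0 < v -> p * u ^+ 2 < q * v ^+ 2 ->
    p * (u / v) < q * (v / u).
  move=> u0 v0 uv; rewrite !mulrA ltr_pdivrMr// mulrAC ltr_pdivlMr//.
  by rewrite -!mulrA -!expr2.
have [|||a [b [ab hab]]] := cantor_sum_itv hC C23 C23 a0 a0
  (strict_derivative_ln_sin s0) (strict_derivative_ln_cos c0).
- rewrite -/s -/c normrN !gtr0_norm ?divr_gt0// -[ltLHS]mul1r lt_ratio//; lra.
- rewrite -/s -/c normrN !gtr0_norm ?divr_gt0// -[ltLHS]mul1r lt_ratio//; lra.
- rewrite -/s -/c normrN !gtr0_norm ?divr_gt0// gt_eqF//.
  rewrite -[ltLHS]mul1r -[ltRHS]mul1r lt_ratio//; lra.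
apply: (@interior_itvoo_neq0 _ _ (expR a) (expR b)); first by rewrite ltr_expR.
move=> z /andP[az zb]; have z0 : 0 < z by apply: lt_trans az; exact: expR_gt0.
have [|u [v [Cu Cv u0 v0 uv]]] := hab (ln z).
  by rewrite -(expRK a) -(expRK b) !ltr_ln ?posrE ?expR_gt0// az.
exists (u, v) => //=.
have su0 : 0 < sin u by apply: sin2_gt0; have := cantor01 hC Cu; lra.
have cv0 : 0 < cos v by apply: cos_gt0_le1; exact: cantor01 Cv.
by rewrite -(lnK z0) -uv expRD !lnK.
Qed.

End cantor.

Theorem corollary1 (R : realType) (C : set R)
    (hC : middle_third_cantor_set C) :
  [/\ (forall alpha beta : R, alpha * beta != 0 ->
         (image_on (open_quadrant R)
            (fun x y => x `^ alpha * y `^ beta) C C)° !=set0),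
      (forall alpha : R, alpha != 0 ->
         (image_on (open_quadrant R)
            (fun x y => x `^ alpha + y `^ alpha) C C)° !=set0 /\
         (image_on (open_quadrant R)
            (fun x y => x `^ alpha - y `^ alpha) C C)° !=set0),
      (image_on setT (fun x y => x + y ^+ 2) C C)° !=set0 /\
      (image_on setT (fun x y => x - y ^+ 2) C C)° !=set0 &
      (image_on setT (fun x y => sin x * cos y) C C)° !=set0].
Proof.
(* Both signs in (ii) and (iii) are instances of a coefficient of absolute value 1. *)
have n1 : `|1 : R| = 1 by rewrite normr1.
have nN1 : `|- 1 : R| = 1 by rewrite normrN1.
split.
- by move=> alpha beta; exact: cantor_powR_mul.
- move=> alpha alpha0; split.
    rewrite (_ : (fun _ _ => _) = fun x y => x `^ alpha + 1 * y `^ alpha).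
      exact: cantor_powR_add.
    by apply/funext => x; apply/funext => y; rewrite mul1r.
  rewrite (_ : (fun _ _ => _) = fun x y => x `^ alpha + -1 * y `^ alpha).
    exact: cantor_powR_add.
  by apply/funext => x; apply/funext => y; rewrite mulN1r.
- split.
    rewrite (_ : (fun _ _ => _) = fun x y => x + 1 * y ^+ 2).
      exact: cantor_add_sqr.
    by apply/funext => x; apply/funext => y; rewrite mul1r.
  rewrite (_ : (fun _ _ => _) = fun x y => x + -1 * y ^+ 2).
    exact: cantor_add_sqr.
  by apply/funext => x; apply/funext => y; rewrite mulN1r.
- exact: cantor_sin_cos.
Qed.
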